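(* Let $F$ be a field of characteristic zero and $n\ge1$. Then $\mathrm{rb}(M_n(F))=2n-1$.
   Context: A linear operator $R$ on $A$ is a Rota–Baxter operator of weight $0$ if $R(x)R(y)=R(R(x)y+xR(y))$ for all $x,y\in A$. The RB-index $\mathrm{rb}(A)$ is the least $n\in\mathbb N$ such that $R^n=0$ for every Rota–Baxter operator $R$ of weight zero on $A$ ($\infty$ if no such $n$ exists). *)

(* Defs.v *)
From HB Require Import structures.
From mathcomp Require Import all_boot all_order all_algebra.
Set Implicit Arguments. Unset Strict Implicit. Unset Printing Implicit Defensive.
Import GRing.Theory.
Local Open Scope ring_scope.

Definition is_RB0 (F : fieldType) (n : nat) (R : 'M[F]_n -> 'M[F]_n) : Prop :=
  linear R /\
  forall x y : 'M[F]_n, R x *m R y = R (R x *m y + x *m R y).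

Definition all_RB0_nilp (F : fieldType) (n k : nat) : Prop :=
  forall R : 'M[F]_n -> 'M[F]_n, is_RB0 R -> forall x, iter k R x = 0.

Definition rb_index_eq (F : fieldType) (n k : nat) : Prop :=
  all_RB0_nilp F n k /\ (forall m : nat, all_RB0_nilp F n m -> (k <= m)%N).

(* Main.v *)
(** Write a = R(1) and ad a = [a, -].  The Rota-Baxter identity gives
    a R(y) - R(a y) = R^2(y) = R(y) a - R(y a), hence R commutes with ad a and
    R(a^j) = a^(j+1) / (j+1).  So the annihilator of a in F[X] is stable under
    integration, which forces the minimal polynomial of a to be a power of X, and
    a^n = 0.  From [a, R^k] = k R^(k+1) one gets R^(2m) = 0 as soon as a^m = 0, which
    settles the case a^(n-1) = 0.  Otherwise a is a regular nilpotent, part of an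
    sl_2-triple with lowering operator f; the (ad a)^k (f^i) with i < n, k <= 2i
    form a basis of M_n(F), and commutation with ad a together with the formula for
    R(a^j) shows that R raises the degree k - i, which takes only 2n - 1 values.
    The bound is attained by a one-sided inverse of ad N, N a nilpotent Jordan
    block. *)

Require Import Defs.
From HB Require Import structures.
From mathcomp Require Import all_boot all_order all_algebra.
From mathcomp Require Import zify ring.
Import GRing.Theory.

Set Implicit Arguments.
Unset Strict Implicit.
Unset Printing Implicit Defensive.

(** * Identities relating a Rota-Baxter operator to [a = R 1] *)

Section UnitalAlgebra.

Local Open Scope ring_scope.

Context (F : fieldType) (A : algType F) (R : {linear A -> A}).
Context (F0 : [pchar F] =i pred0).
Context (RB : forall x y, R x * R y = R (R x * y + x * R y)).

Local Notation a := (R 1).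

Lemma natf_neq0 n : (n.+1%:R : F) != 0.
Proof. by rewrite (proj1 (pcharf0P F) F0). Qed.

Lemma RB_mul1 y : a * R y = R (a * y) + R (R y).
Proof. by rewrite RB linearD mul1r. Qed.

Lemma RB_mulr1 y : R y * a = R (y * a) + R (R y).
Proof. by rewrite RB linearD mulr1 addrC. Qed.

Lemma RB_comm y : R (a * y - y * a) = a * R y - R y * a.
Proof.
by rewrite RB_mul1 RB_mulr1 linearB opprD addrACA subrr addr0.
Qed.

Lemma RB_mul1_iter k y :
  a * iter k R y = iter k R (a * y) + k%:R *: iter k.+1 R y.
Proof.
elim: k y => [|k IHk] y; first by rewrite scale0r addr0.
rewrite iterS RB_mul1 IHk linearD linearZ /= -addrA -[X in _ + (_ + X)]scale1r.
by rewrite -scalerDl -natr1.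
Qed.

Lemma RB_exp j : R (a ^+ j) = j.+1%:R^-1 *: a ^+ j.+1.
Proof.
elim: j => [|j IHj]; first by rewrite invr1 scale1r.
apply: (scalerI (natf_neq0 j.+1)).
rewrite scalerA divff ?natf_neq0 // scale1r.
have := RB_mul1 (a ^+ j); rewrite -exprS IHj linearZ /= -scalerAr -exprS.
move/(congr1 (fun x => j.+1%:R *: x)).
rewrite scalerDr !scalerA divff ?natf_neq0 // !scale1r => ->.
by rewrite -[X in _ + X]scale1r -scalerDl natr1.
Qed.

(** By [RB_mul1_iter] one factor [R] can be traded for a factor [a] on the left or next to [y],
    which keeps [i + j + k] fixed. Once a single [R] is left, [i + j >= 2m - 1] forces [i >= m] or
    [j >= m]. *)
Lemma RB_iter_expl m (am0 : a ^+ m = 0) k i j y :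
  (m.*2 <= i + j + k.+1)%N -> a ^+ i * iter k.+1 R (a ^+ j * y) = 0.
Proof.
have nil l : (m <= l)%N -> a ^+ l = 0.
  by move=> le_ml; rewrite -(subnKC le_ml) exprD am0 mul0r.
elim: k i j => [|k IHk] i j le_m.
  have [le_mi|lt_im] := leqP m i; first by rewrite nil ?mul0r.
  by rewrite [a ^+ j]nil ?mul0r /= ?linear0 ?mulr0 //; lia.
apply: (scalerI (natf_neq0 k)); rewrite scaler0 scalerAr.
have /(canRL (addKr _)) -> := esym (RB_mul1_iter k.+1 (a ^+ j * y)).
rewrite addrC mulrDr mulrN !mulrA -exprSr -exprS.
by rewrite !IHk ?oppr0 ?addr0 //; lia.
Qed.

Lemma RB_iter_eq0 m k y :
  a ^+ m = 0 -> (0 < k)%N -> (m.*2 <= k)%N -> iter k R y = 0.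
Proof.
case: k => // k am0 _ le_mk.
by have := @RB_iter_expl _ am0 k 0 0 y le_mk; rewrite !expr0 !mul1r.
Qed.

End UnitalAlgebra.

(** * Nilpotency of [R 1] in a matrix algebra *)

Section MatrixNilpotent.

Local Open Scope ring_scope.

Context (F : fieldType) (n : nat) (R : {linear 'M[F]_n.+1 -> 'M[F]_n.+1}).
Context (F0 : [pchar F] =i pred0).
Context (RB : forall x y, R x * R y = R (R x * y + x * R y)).

(** The formal antiderivative. Its constant term is zero because the inverse of [0%:R] is [0]. *)
Definition int_poly (p : {poly F}) : {poly F} :=
  \poly_(i < (size p).+1) (p`_i.-1 / i%:R).

Lemma RB_horner p : R (horner_mx (R 1) p) = horner_mx (R 1) (int_poly p).
Proof.
rewrite /int_poly poly_def big_ord_recl invr0 mulr0 scale0r add0r.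
rewrite -[in LHS](coefK p) poly_def !linear_sum; apply: eq_bigr => i _ /=.
by rewrite !linearZ /= !rmorphXn /= !horner_mx_X RB_exp ?scalerA.
Qed.

Lemma int_poly_coef p i : (int_poly p)`_i = p`_i.-1 / i%:R.
Proof.
rewrite coef_poly; case: ltnP => // le_pi.
by rewrite nth_default ?mul0r //; case: i le_pi.
Qed.

Lemma RB1_nilpotent : R 1 ^+ n.+1 = 0.
Proof.
set a := R 1; set p := mxminpoly a; set d := degree_mxminpoly a.
have sz_p : size p = d.+1 := size_mxminpoly a.
have p_a : horner_mx a p = 0 := mx_root_minpoly a.
have pd : p`_d = 1.
  by have := monicP (mxminpoly_monic a); rewrite /lead_coef -/p sz_p.
(* The factor [d + 1] cancels the terms of degree [d + 1], so [q] has degree at most [d]; since it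
   annihilates [a], it is a multiple of [p]. *)
pose q := d.+1%:R *: int_poly p - 'X * p.
have q_a : horner_mx a q = 0.
  by rewrite linearB linearZ /= rmorphM /= p_a -RB_horner p_a linear0 scaler0
             mulr0 subr0.
have qE i : q`_i.+1 = (d.+1%:R / i.+1%:R - 1) * p`_i.
  rewrite coefB coefZ int_poly_coef coefXM /=.
  by rewrite mulrBl mul1r mulrA mulrAC.
have q0 : q`_0 = 0 by rewrite coefB coefZ int_poly_coef coefXM /= invr0 !mulr0 subrr.
have q_p : q = q`_d *: p.
  apply/eqP; rewrite -subr_eq0; apply: contraT => /dvdp_leq le_p.
  have: (size p <= size (q - q`_d *: p)%R)%N.
    by apply/le_p/mxminpoly_min; rewrite linearB linearZ /= p_a q_a scaler0 subrr.
  rewrite sz_p leqNgt ltnS => /negP[]; apply/leq_sizeP => i.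
  rewrite leq_eqVlt => /predU1P[<-|].
    by rewrite coefB coefZ pd mulr1 subrr.
  case: i => [|i]; first by rewrite ltn0.
  rewrite ltnS leq_eqVlt coefB coefZ => /predU1P[<-|lt_di].
    rewrite qE divff ?(natf_neq0 F0) // subrr mul0r.
    by rewrite [p`__]nth_default ?sz_p // mulr0 subrr.
  by rewrite qE (nth_default _ (_ : (size p <= i)%N)) ?(nth_default _ (_ : (size p <= i.+1)%N)) ?sz_p ?mulr0 ?subrr // ltnW.
(* Compare coefficients in [q = q_d p]. If [q_d = 0], the factor [(d + 1)/(i + 1) - 1] is nonzero
   for [i < d], so [p_i = 0]. Otherwise [q_0 = 0] gives [p_0 = 0], and zeros propagate upwards. *)
have p_lt i : (i < d)%N -> p`_i = 0.
  have [qd0|qd_neq0] := eqVneq q`_d 0.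
    move=> lt_id; have := qE i; rewrite q_p qd0 scale0r coef0 => /esym/eqP.
    rewrite mulf_eq0 subr_eq0 => /orP[/eqP di|/eqP//].
    have: ((d - i)%:R : F) == 0.
      have -> : (d - i = d.+1 - i.+1)%N by lia.
      rewrite natrB; last lia.
      move/(congr1 (fun z => z * i.+1%:R)): di.
      by rewrite divfK ?mul1r ?(natf_neq0 F0) // => ->; rewrite subrr.
    by rewrite (proj1 (pcharf0P F) F0) subn_eq0 leqNgt lt_id.
  suff pi0 : p`_i = 0 by [].
  elim: i => [|i IHi].
    by apply/eqP; have/eqP := q0; rewrite {1}q_p coefZ mulf_eq0 (negPf qd_neq0).
  apply/eqP; have /eqP := qE i; rewrite {1}q_p coefZ IHi mulr0 mulf_eq0.
  by rewrite (negPf qd_neq0).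
have pX : p = 'X^d.
  apply/polyP => i; rewrite coefXn; case: ltngtP => [/p_lt//|lt_di|-> //].
  by rewrite nth_default ?sz_p.
have le_d : (d <= n.+1)%N.
  have := dvdp_leq _ (mxminpoly_dvd_char a).
  by rewrite -/p sz_p size_char_poly ltnS; apply; rewrite -size_poly_gt0 size_char_poly.
have ad : a ^+ d = 0 by rewrite -{1}(horner_mx_X a) -rmorphXn -pX.
have -> : a ^+ n.+1 = a ^+ d * a ^+ (n.+1 - d) by rewrite -exprD subnKC.
by rewrite ad mul0r.
Qed.

End MatrixNilpotent.

(** * Linearity of iterates *)

Section IterLinear.

Local Open Scope ring_scope.

Context (F : fieldType) (U : lmodType F) (f : {linear U -> U}) (m : nat).

Lemma iter_is_linear : linear (iter m f).
Proof. by elim: m => // k IHk c x y; rewrite !iterS IHk linearP. Qed.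

HB.instance Definition _ :=
  GRing.isLinear.Build F U U *:%R (iter m f) iter_is_linear.

End IterLinear.

(** * Iterated inner derivations on powers of a lowering element *)

Section InnerDerivation.

Local Open Scope ring_scope.

Context (F : fieldType) (A : algType F) (a : A).

Definition ad (x : A) : A := a * x - x * a.

Lemma ad_is_linear : linear ad.
Proof.
move=> c x y; rewrite /ad mulrDr mulrDl -scalerAr -scalerAl opprD addrACA.
by rewrite -scalerBr.
Qed.

HB.instance Definition _ := GRing.isLinear.Build F A A *:%R ad ad_is_linear.

Lemma adM x y : ad (x * y) = ad x * y + x * ad y.
Proof. by rewrite /ad mulrBl mulrBr !mulrA addrA subrK. Qed.

Lemma ad_id : ad a = 0.
Proof. exact: subrr. Qed.

Context (f : A) (ad2f : ad (ad f) = - (a *+ 2)).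

(** The Leibniz formula stops after three terms, since [ad f] applied to [a] direction ends there:
    the third derivative of [f] is [-2 [a, a] = 0]. *)
Lemma iter_ad_mul m y :
  iter m.+2 ad (f * y) =
    f * iter m.+2 ad y + (ad f * iter m.+1 ad y) *+ m.+2
    - (a * iter m ad y) *+ (m.+2 * m.+1).
Proof.
elim: m => [|m IHm].
  rewrite /= !adM linearD /= !adM ad2f mulNr mulrnAl mulr2n.
  rewrite addrA addrC -(addrA _ (ad f * ad y)) [X in _ + X]addrC addrA.
  by rewrite -mulr2n.
rewrite iterS IHm linearB linearD !raddfMn /= !adM ad2f ad_id mul0r add0r.
rewrite mulNr mulrnAl mulrnDl !mulNrn -mulrnA [X in _ + X + _]addrC addrA.
rewrite [X in X + _ + _ + _]addrC -[X in X + _ + _]addrA -mulrS -addrA -opprD.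
rewrite -mulrnDr; congr (_ - _ *+ _).
lia.
Qed.

Lemma iter_ad_exp_gt i m : (i.*2 < m)%N -> iter m ad (f ^+ i) = 0.
Proof.
elim: i m => [|i IHi] [|[|m]] //.
- by move=> _; rewrite /= /ad mulr1 mul1r subrr.
- by move=> _; rewrite 2!iterSr /= {3}/ad mulr1 mul1r subrr !linear0.
rewrite doubleS !ltnS exprS iter_ad_mul => lt_im.
by rewrite !IHi ?mulr0 ?mul0rn ?addr0 ?subrr //; lia.
Qed.

(** Each factor [f] absorbs exactly two derivations and becomes [-2a]; there are [(2i)!/2^i] ways to
    distribute them. *)
Lemma iter_ad_exp i :
  iter i.*2 ad (f ^+ i) = ((-1) ^+ i * (i.*2)`!%:R) *: a ^+ i.
Proof.
elim: i => [|i IHi]; first by rewrite mul1r scale1r.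
rewrite doubleS exprS iter_ad_mul IHi !iter_ad_exp_gt ?leqnSn //.
rewrite !mulr0 mul0rn !add0r -scalerAr -exprS scalerMnl -scaleNr.
congr (_ *: _); rewrite !factS exprS mulN1r mulNr mulnA natrM -mulr_natr.
by rewrite -mulrA [_ * _%:R in LHS]mulrC.
Qed.

End InnerDerivation.

(** * The upper bound when [a] is a regular nilpotent *)

Section RegularNilpotent.

Local Open Scope ring_scope.

Context (F : fieldType) (n : nat) (F0 : [pchar F] =i pred0).

Local Notation M := 'M[F]_n.+1.

Context (a f : M) (an0 : a ^+ n.+1 = 0) (an_neq0 : a ^+ n != 0).
Context (ad2f : ad a (ad a f) = - (a *+ 2)).

Local Notation D := (ad a).

(* The pair (p, q) stands for ad a ^ k (f ^ i) with i = max(p, q) and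
   k - i = p - q; as p and q range over [0, n], each (i, k) with i <= n and
   k <= 2 i occurs exactly once. *)
Definition ad_string (p q : nat) : M := iter (maxn p q + p - q) D (f ^+ maxn p q).

(** Storing the coefficients in a matrix makes this an endomorphism of [M], so that injectivity
    yields surjectivity. *)
Definition ad_strings (C : M) : M := \sum_s C s.1 s.2 *: ad_string s.1 s.2.

Lemma fact_sign_neq0 i : (-1) ^+ i * (i.*2)`!%:R != 0 :> F.
Proof.
by rewrite mulf_neq0 ?signr_eq0 // (proj1 (pcharf0P F) F0) -lt0n fact_gt0.
Qed.

Lemma maxnD_subn p q :
  (maxn p q + q - p + (maxn p q + p - q) = (maxn p q).*2)%N.
Proof. lia. Qed.

(** The number [maxn p q + q - p] counts the derivations that still carry the string element to a
    multiple of a power of [a]. The case [m = 0] is linear independence. *)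
Lemma iter_ad_strings_eq0 C m (p q : 'I_n.+1) :
  iter m D (ad_strings C) = 0 -> (m <= maxn p q + q - p)%N -> C p q = 0.
Proof.
move=> C0 le_m; apply/eqP; apply: contraT => Cpq.
pose rem (s : 'I_n.+1 * 'I_n.+1) := (maxn s.1 s.2 + s.2 - s.1)%N.
(* This weight encodes a lexicographic order: most remaining derivations first, then the least
   exponent of [f]. *)
pose w s := (rem s * n.+1 + (n - maxn s.1 s.2))%N.
case: (@arg_maxnP _ (p, q) (fun s => C s.1 s.2 != 0) w Cpq) => s Cs max_s.
have le_n (t : 'I_n.+1 * 'I_n.+1) : (maxn t.1 t.2 <= n)%N.
  by rewrite geq_max !leq_ord.
have lex t : C t.1 t.2 != 0 ->
    (rem t < rem s)%N \/ rem t = rem s /\ (maxn s.1 s.2 <= maxn t.1 t.2)%N.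
  move=> /max_s; rewrite /w; move: (le_n s) (le_n t); move: (rem s) (rem t).
  by move: (maxn s.1 s.2) (maxn t.1 t.2) => x y u v /= ? ? ?; nia.
have le_rem : (m <= rem s)%N.
  by apply: leq_trans le_m _; case: (lex (p, q) Cpq) => [/ltnW //|[<- _]].
(* The derivations kill the terms with fewer steps left and turn the others into multiples of powers
   of [a]; the left factor then kills every power but the lowest, which becomes [a ^+ n]. *)
have: a ^+ (n - maxn s.1 s.2) * iter (rem s) D (ad_strings C) = 0.
  by rewrite -(subnK le_rem) iterD C0 linear0 mulr0.
rewrite linear_sum mulr_sumr (bigD1 s) //= big1 ?addr0 => [|t neq_ts].
  rewrite linearZ /= /ad_string -iterD.
  have -> : (rem s + (maxn s.1 s.2 + s.1 - s.2) = (maxn s.1 s.2).*2)%N.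
    exact: maxnD_subn.
  rewrite iter_ad_exp // scalerA -scalerAr -exprD subnK ?le_n // => /eqP.
  by rewrite scaler_eq0 (negPf an_neq0) mulf_eq0 (negPf Cs) (negPf (fact_sign_neq0 _)).
have [->|Ct] := eqVneq (C t.1 t.2) 0; first by rewrite scale0r linear0 mulr0.
rewrite linearZ /= /ad_string -iterD.
have [lt_rem|[eq_rem le_max]] := lex t Ct.
  rewrite iter_ad_exp_gt ?scaler0 ?mulr0 //.
  by rewrite -maxnD_subn ltn_add2r.
have lt_max : (maxn s.1 s.2 < maxn t.1 t.2)%N.
  rewrite ltn_neqAle le_max andbT; apply: contra neq_ts => /eqP eq_max.
  move: eq_rem eq_max; rewrite /rem -pair_eqE /pair_eq /= -!val_eqE /=.
  by move: (val s.1) (val s.2) (val t.1) (val t.2) => *; lia.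
rewrite -eq_rem.
have -> : (rem t + (maxn t.1 t.2 + t.1 - t.2) = (maxn t.1 t.2).*2)%N.
  exact: maxnD_subn.
rewrite iter_ad_exp // -!scalerAr -exprD.
rewrite (_ : (_ + _ = n.+1 + (maxn t.1 t.2 - (maxn s.1 s.2).+1))%N).
  by rewrite exprD an0 mul0r !scaler0.
by move: (le_n s) lt_max; move: (maxn s.1 s.2) (maxn t.1 t.2) => *; lia.
Qed.

Lemma ad_strings_is_linear : linear ad_strings.
Proof.
move=> c x y; rewrite /ad_strings scaler_sumr -big_split /=.
by apply: eq_bigr => s _; rewrite !mxE scalerDl scalerA.
Qed.

HB.instance Definition _ :=
  GRing.isLinear.Build F M M *:%R ad_strings ad_strings_is_linear.

Lemma ad_strings_surj x : exists C, x = ad_strings C.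
Proof.
have ker0 : lker (linfun ad_strings) == 0%VS.
  apply/lker0P => x1 x2; rewrite !lfunE /= => eq_x.
  apply/matrixP => p q; apply/eqP; rewrite -subr_eq0; apply/eqP.
  have := @iter_ad_strings_eq0 (x1 - x2) 0 p q; rewrite !mxE; apply => //=.
  by rewrite linearB /= eq_x subrr.
exists ((linfun ad_strings)^-1%VF x).
by rewrite -[in RHS](lfunE ad_strings) lker0_lfunVK.
Qed.

Context (R : {linear M -> M}).
Context (R_ad : forall x, R (D x) = D (R x)).
Context (R_exp : forall j, R (a ^+ j) = j.+1%:R^-1 *: a ^+ j.+1).

Lemma iter_ad_R k x : R (iter k D x) = iter k D (R x).
Proof. by elim: k => //= k <-; rewrite R_ad. Qed.

(** Induction on [m]: [R] raises the degree [k - i], which is at most [n] on nonzero strings. *)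
Lemma iter_R_string m i k :
  (i <= n)%N -> (n.+1 + i <= m + k)%N -> iter m R (iter k D (f ^+ i)) = 0.
Proof.
elim: m i k => [|m IHm] i k le_in le_k; first by rewrite /= iter_ad_exp_gt //; lia.
rewrite iterSr iter_ad_R.
(* Here [z] is an explicit part of [R (f ^+ i)], a multiple of [D (D (f ^+ i.+1))] of degree
   [1 - i], scaled so that [R (f ^+ i) - z] is killed by [iter i.*2 D]. For [i = n] both sides
   vanish and [z = 0]. *)
have [z z_top z0] : exists2 z, iter i.*2 D z = R (iter i.*2 D (f ^+ i))
    & iter m R (iter k D z) = 0.
  have [->|neq_in] := eqVneq i n.
    by exists 0; rewrite ?linear0 ?iter_ad_exp // linearZ /= R_exp an0 !scaler0.
  pose c j : F := (-1) ^+ j * (j.*2)`!%:R.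
  exists ((c i / i.+1%:R / c i.+1) *: D (D (f ^+ i.+1))).
    rewrite linearZ /= -!iterSr -doubleS !iter_ad_exp // [RHS]linearZ /= R_exp !scalerA.
    by rewrite divfK ?fact_sign_neq0.
  rewrite !linearZ /= -!iterSr IHm ?scaler0 //; lia.
have [C defC] := ad_strings_surj (R (f ^+ i) - z).
rewrite -[R _](subrK z) linearD linearD /= z0 addr0 defC !linear_sum.
apply: big1 => -[p q] _ /=; rewrite !linearZ /= -iterD.
(* Terms of degree [p - q <= -i] have at least [2i] derivations left, so their coefficients vanish;
   the others have degree above that of [f ^+ i]. *)
have [le_pq|lt_qp] := leqP (p + i) q.
  rewrite (@iter_ad_strings_eq0 C i.*2 p q) ?scale0r //; last by lia.
  by rewrite -defC linearB /= z_top iter_ad_R subrr.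
rewrite IHm ?scaler0 //; last lia.
by rewrite geq_max !leq_ord.
Qed.

Lemma iter_R_regular x : iter n.*2.+1 R x = 0.
Proof.
have [C ->] := ad_strings_surj x; rewrite linear_sum; apply: big1 => -[p q] _ /=.
have le_n : (maxn p q <= n)%N by rewrite geq_max !leq_ord.
by rewrite !linearZ /= -iterS /ad_string iter_R_string ?scaler0 //; lia.
Qed.

End RegularNilpotent.

(** * The sl_2-triple of a nilpotent Jordan block, and conjugation to it *)

Section JordanBlock.

Local Open Scope ring_scope.

Context (F : fieldType) (n : nat).

Local Notation M := 'M[F]_n.+1.

Definition shift : M := \matrix_(i, j) ((j : nat) == i.+1)%:R.

Lemma shift_mulE (x : M) i j :
  (shift * x) i j = if (i < n)%N then x (inord i.+1) j else 0.
Proof.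
rewrite mxE; case: ifPn => [lt_in|ge_in].
  rewrite (bigD1 (inord i.+1)) //= mxE inordK // eqxx mul1r big1 ?addr0 // => k.
  by rewrite -val_eqE /= inordK // mxE => /negPf->; rewrite mul0r.
rewrite big1 // => k _; rewrite mxE.
by have := ltn_ord k; case: eqP => [|_ _]; [lia | rewrite mul0r].
Qed.

Lemma mul_shiftE (x : M) i j :
  (x * shift) i j = if (0 < j)%N then x i (inord j.-1) else 0.
Proof.
rewrite mxE; case: ifPn => [lt_0j|ge_j0].
  have jK : @nat_of_ord n.+1 (inord j.-1) = j.-1.
    by rewrite inordK //; have := ltn_ord j; lia.
  rewrite (bigD1 (inord j.-1)) //= mxE jK prednK // eqxx mulr1 big1 ?addr0 // => k.
  rewrite -val_eqE /= jK mxE => neq_k.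
  by case: eqP => [|_]; [lia | rewrite mulr0].
by rewrite big1 // => k _; rewrite mxE; case: eqP => [|_]; [lia | rewrite mulr0].
Qed.

(* The lowering operator of the irreducible sl_2-module of dimension n + 1. *)
Definition lowering : M :=
  \matrix_(i, j) (((i : nat) == j.+1)%:R * (i * (n.+1 - i))%:R).

(** This is the Cartan element of the triple, with weights [n, n - 2, ..., -n], from
    [(i + 1)(n - i) - i(n + 1 - i) = n - 2i]. *)
Lemma ad_lowering :
  ad shift lowering = \matrix_(i, j) ((i == j)%:R * (n%:R - i.*2%:R)).
Proof.
apply/matrixP => i j; rewrite mxE [X in _ + X]mxE shift_mulE mul_shiftE !mxE.
have [lti ltj] := (ltn_ord i, ltn_ord j).
have jK : @nat_of_ord n.+1 (inord j.-1) = j.-1 by rewrite inordK //; lia.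
have iK : (i < n)%N -> @nat_of_ord n.+1 (inord i.+1) = i.+1 by move=> ?; rewrite inordK.
have -> : (if (i < n)%N then
    ((@nat_of_ord n.+1 (inord i.+1) == j.+1)%:R * (@inord n i.+1 * (n.+1 - @inord n i.+1))%:R)
    else 0) = (i == j)%:R * (i.+1 * (n - i))%:R :> F.
  case: ltnP => [lt_in|le_ni]; first by rewrite iK // subSS eqSS val_eqE.
  by rewrite (_ : (n - i = 0)%N) ?muln0 ?mulr0 //; lia.
have -> : (if (0 < j)%N then
    ((i : nat) == (@inord n j.-1).+1)%:R * (i * (n.+1 - i))%:R else 0)
    = (i == j)%:R * (i * (n.+1 - i))%:R :> F.
  case: ltnP => [lt_0j|le_j0]; first by rewrite jK prednK // val_eqE.
  have [->|_] := eqVneq i j; last by rewrite mul0r.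
  by rewrite (_ : nat_of_ord j = 0%N) ?mul0n ?mulr0 //; lia.
rewrite -mulrBr; congr (_ * _).
have -> : (n.+1 - i = (n - i).+1)%N by lia.
have nE : n%:R = i%:R + (n - i)%:R :> F by rewrite -natrD subnKC //; lia.
by rewrite nE -muln2 !natrM -!natr1; ring.
Qed.

Lemma ad2_lowering : ad shift (ad shift lowering) = - (shift *+ 2).
Proof.
rewrite ad_lowering; apply/matrixP => i j.
rewrite mxE [X in _ + X]mxE shift_mulE mul_shiftE ?mxE.
have [lti ltj] := (ltn_ord i, ltn_ord j).
have jK : @nat_of_ord n.+1 (inord j.-1) = j.-1 by rewrite inordK //; lia.
have [eq_ji|neq_ji] := eqVneq (j : nat) i.+1.
  have -> : (i < n)%N by lia.
  have -> : (0 < j)%N by lia.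
  have -> : @inord n i.+1 = j by apply/val_inj; rewrite /= inordK // -eq_ji.
  have -> : @inord n j.-1 = i by apply/val_inj; rewrite /= jK eq_ji.
  rewrite !eqxx eq_ji doubleS !mul1r -!natr1 -mulr_natr; ring.
have -> : (if (i < n)%N then (@inord n i.+1 == j)%:R * (n%:R - (@inord n i.+1).*2%:R) else 0) = 0 :> F.
  case: ltnP => // lt_in; rewrite -val_eqE /= inordK // eq_sym (negPf neq_ji).
  by rewrite mul0r.
case: ltnP => // lt_0j; last by rewrite mulr0n sub0r addr0.
rewrite -val_eqE /= jK; case: eqP => [|_]; first lia.
by rewrite mulr0n mul0r sub0r addr0.
Qed.

Lemma regular_nilpotent_conj (a : M) : a ^+ n.+1 = 0 -> a ^+ n != 0 ->
  exists2 P : M, P \is a GRing.unit & P * a = shift * P.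
Proof.
move=> an0 an_neq0.
have nil l : (n < l)%N -> a ^+ l = 0.
  by move=> le_nl; rewrite -(subnKC le_nl) exprD an0 mul0r.
have [i0 b_neq0] : exists i, row i (a ^+ n) != 0.
  apply/existsP; apply: contraT; rewrite negb_exists => /forallP all_row0.
  case/eqP: an_neq0; apply/row_matrixP => i; rewrite row0.
  by apply/eqP; have := all_row0 i; rewrite negbK.
(* The rows are [e, e a, ..., e a^n] for a basis vector [e] with [e a^n] nonzero, that is, a cyclic
   basis. *)
pose P : M := \matrix_(i, j) (a ^+ i) i0 j.
have rowP_ i : row i P = row i0 (a ^+ i) by apply/rowP => j; rewrite !mxE.
exists P; last first.
  apply/row_matrixP => i; rewrite row_mul rowP_ -row_mul.
  have -> : a ^+ i *m a = a ^+ i.+1 by rewrite exprSr.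
  apply/rowP => j; rewrite [RHS]mxE shift_mulE !mxE.
  case: ltnP => [lt_in|le_ni]; first by rewrite inordK.
  by rewrite nil ?mxE.
suff: row_free P by rewrite row_free_unit.
apply: inj_row_free => v vP0.
apply/eqP; apply: contraT => /rV0Pn[k0 vk0].
case: (@arg_minnP _ k0 (fun k => v 0 k != 0) (@nat_of_ord _) vk0) => k vk min_k.
(* With [k] the least index in the relation, multiplying by [a ^+ (n - k)] leaves only the multiple
   of [e a^n]. *)
have := congr1 (mulmx^~ (a ^+ (n - k))) vP0; rewrite /= mul0mx -mulmxA.
have rowPa i : row i (P *m a ^+ (n - k)) = row i0 (a ^+ (i + (n - k))).
  by rewrite row_mul rowP_ -row_mul exprD.
rewrite mulmx_sum_row (bigD1 k) //= big1 ?addr0 => [/eqP|i neq_ik].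
  by rewrite rowPa subnKC ?leq_ord // scaler_eq0 (negPf vk) (negPf b_neq0).
have [->|vi] := eqVneq (v 0 i) 0; first by rewrite scale0r.
have := min_k i vi; rewrite leq_eqVlt val_eqE eq_sym (negPf neq_ik) /= => lt_ki.
by rewrite rowPa nil ?row0 ?scaler0 //; have := leq_ord k; lia.
Qed.

Lemma regular_nilpotent_lowering (a : M) : a ^+ n.+1 = 0 -> a ^+ n != 0 ->
  exists f, ad a (ad a f) = - (a *+ 2).
Proof.
move=> an0 /(regular_nilpotent_conj an0)[P unitP Pa].
have aE : a = P^-1 * shift * P by rewrite -mulrA -Pa mulKr.
exists (P^-1 * lowering * P).
have adE x : ad a (P^-1 * x * P) = P^-1 * ad shift x * P.
  by rewrite /ad aE mulrBr mulrBl !mulrA !mulrK.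
rewrite !adE ad2_lowering mulrN mulNr mulr2n mulrDr mulrDl -aE.
by rewrite mulr2n.
Qed.

End JordanBlock.

(** * An operator attaining the bound *)

Section ExtremalOperator.

Local Open Scope ring_scope.

Context (F : fieldType) (n : nat).

Local Notation M := 'M[F]_n.+1.
Local Notation N := ((shift F n)^T : M).

Lemma ad_shiftTE (y : M) (i j : 'I_n.+1) : ad N y i j =
  (if (0 < i)%N then y (inord i.-1) j else 0)
  - (if (j < n)%N then y i (inord j.+1) else 0).
Proof.
rewrite /ad mxE [X in _ + X]mxE; congr (_ - _).
  have -> : N * y = (y^T * shift F n)^T by rewrite trmx_mul trmxK.
  by rewrite mxE mul_shiftE mxE.
have -> : y * N = (shift F n * y^T)^T by rewrite trmx_mul trmxK.
by rewrite mxE shift_mulE mxE.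
Qed.

(* The last column of the image records the last row of the argument. *)
Definition ad_mod (y : M) : M :=
  \matrix_(i, j) if j == ord_max then y ord_max i else ad N y i j.

Lemma ad_mod_is_linear : linear ad_mod.
Proof.
move=> c x y; apply/matrixP => i j; rewrite mxE linearP !mxE.
by case: eqP.
Qed.

HB.instance Definition _ :=
  GRing.isLinear.Build F M M *:%R ad_mod ad_mod_is_linear.

(** Off the last column, [ad N y = 0] makes [y] constant along diagonals, with zeros entering at the
    top row. Diagonals with [j <= i] end in the last row, which is zero; those with [j > i] start in
    the top row. *)
Lemma ad_mod_eq0 y : ad_mod y = 0 -> y = 0.
Proof.
move=> y0; pose Y i j := y (inord i) (inord j).
have last0 j : Y n j = 0.
  have := congr1 (fun z : M => z (inord j) ord_max) y0; rewrite !mxE eqxx.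
  by rewrite /Y (_ : inord n = ord_max) //; apply/val_inj; rewrite /= inordK.
have diag i j : (i <= n)%N -> (j < n)%N ->
    Y i j.+1 = if (0 < i)%N then Y i.-1 j else 0.
  move=> le_in lt_jn.
  have := congr1 (fun z : M => z (inord i) (inord j)) y0; rewrite mxE [RHS]mxE.
  rewrite -val_eqE /= inordK ?ltn_eqF ?ltnS ?(ltnW lt_jn) // ad_shiftTE.
  rewrite !inordK ?ltnS ?(ltnW lt_jn) // lt_jn => /eqP.
  by rewrite /Y subr_eq0 => /eqP <-.
have lower m : forall i j, (i + m = n)%N -> (j <= i)%N -> Y i j = 0.
  elim: m => [|m IHm] i j; first by rewrite addn0 => -> _; apply: last0.
  move=> eq_im le_ji; have := diag i.+1 j; rewrite /= => <-; try lia.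
  by apply: IHm; lia.
have upper i : forall j, (i < j <= n)%N -> Y i j = 0.
  elim: i => [|i IHi] [|j] // lt_ij; rewrite diag //; try lia.
  by apply: IHi; lia.
apply/matrixP => i j; rewrite mxE -(inord_val i) -(inord_val j) -/(Y i j).
have [le_ji|lt_ij] := leqP j i; last by apply: upper; rewrite lt_ij leq_ord.
by apply: (lower (n - i)%N); rewrite // subnKC // leq_ord.
Qed.

Lemma ad_mod_inv : exists S : {linear M -> M}, cancel S ad_mod.
Proof.
have ker0 : lker (linfun ad_mod) == 0%VS.
  apply/lker0P => x y; rewrite !lfunE /= => eq_xy.
  by apply/eqP; rewrite -subr_eq0; apply/eqP/ad_mod_eq0; rewrite linearB /= eq_xy subrr.
exists ((linfun ad_mod)^-1%VF) => x.
by rewrite -[LHS](lfunE ad_mod) lker0_lfunVK.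
Qed.

Definition drop_last_col (x : M) : M :=
  \matrix_(i, j) if j == ord_max then 0 else x i j.

Lemma drop_last_col_is_linear : linear drop_last_col.
Proof.
move=> c x y; apply/matrixP => i j; rewrite !mxE.
by case: eqP => _; rewrite // mulr0 addr0.
Qed.

HB.instance Definition _ :=
  GRing.isLinear.Build F M M *:%R drop_last_col drop_last_col_is_linear.

(* R x is the unique y with zero last row such that ad N y and x differ only in
   the last column.  As ad N is a derivation, R inherits the Rota-Baxter
   identity from the Leibniz rule: the error terms are matrices supported on the
   last column, killed by right multiplication by Im R and stable under left
   multiplication. *)
Lemma inverse_ad_RB0 : exists R : {linear M -> M},
  [/\ forall x y, ad_mod y = drop_last_col x -> R x = y,
      forall x, ad_mod (R x) = drop_last_col x & @is_RB0 F n.+1 R].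
Proof.
have [S SK] := ad_mod_inv.
have ad_mod_inj : injective ad_mod.
  move=> x y eq_xy; apply/eqP; rewrite -subr_eq0; apply/eqP/ad_mod_eq0.
  by rewrite linearB /= eq_xy subrr.
pose R : {linear M -> M} := S \o drop_last_col.
have RK x : ad_mod (R x) = drop_last_col x by rewrite /= SK.
have R_uniq x y : ad_mod y = drop_last_col x -> R x = y.
  by move=> eq_xy; apply: ad_mod_inj; rewrite RK.
exists R; split => //; split; first by move=> c x y; rewrite linearP.
have last0 x j : R x ord_max j = 0.
  by have := congr1 (fun z : M => z j ord_max) (RK x); rewrite !mxE eqxx.
have adR x i j : j != ord_max -> ad N (R x) i j = x i j.
  move=> /negPf neq_j; have := congr1 (fun z : M => z i j) (RK x).
  by rewrite mxE [RHS]mxE neq_j.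
move=> x y; apply/esym/R_uniq/matrixP => i j; rewrite mxE [RHS]mxE.
case: eqP => [_|/eqP neq_j]; first rewrite mxE.
  by rewrite big1 // => k _; rewrite last0 mul0r.
have -> : R x *m R y = R x * R y by [].
rewrite adM [in RHS]addrC mxE [RHS]mxE; congr (_ + _); rewrite mxE [RHS]mxE.
  apply: eq_bigr => k _.
  have [->|neq_k] := eqVneq k ord_max; first by rewrite last0 !mulr0.
  by rewrite adR.
by apply: eq_bigr => k _; rewrite adR.
Qed.

Lemma RB0_lower_bound m : all_RB0_nilp F n.+1 m -> (n.*2.+1 <= m)%N.
Proof.
move=> nilp; rewrite ltnNge; apply/negP => le_m.
have [R [R_uniq RK RB]] := inverse_ad_RB0.
have R0 x : iter n.*2 R x = 0.
  by rewrite -(subnK le_m) iterD nilp // linear0.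
(* Since [ad N] moves the unit matrix at [(i, 0)] to the one at [(i + 1, 0)], [R] climbs the first
   column in [n] steps. *)
have colE i : (i <= n)%N ->
    iter i R (delta_mx (inord i) ord0) = delta_mx ord0 ord0.
  elim: i => [_|i IHi lt_in].
    by congr delta_mx; apply/val_inj; rewrite /= inordK.
  rewrite iterSr -IHi ?(ltnW lt_in) //; congr (iter _ _ _).
  apply: R_uniq; apply/matrixP => p q; rewrite mxE [RHS]mxE.
  case: eqP => [_|_].
    by rewrite mxE -val_eqE /= inordK ?gtn_eqF // ltnS ltnW.
  rewrite ad_shiftTE [X in _ - X](_ : _ = 0) ?subr0; last first.
    case: ltnP => // lt_qn.
    by rewrite mxE -[X in _ && X]val_eqE /= inordK // andbF.
  rewrite !mxE -![_ == inord _]val_eqE /= !inordK ?ltnS ?(ltnW lt_in) //; last first.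
    by have := ltn_ord p; lia.
  by case: (nat_of_ord p).
(* In the top row [ad N y] is [y] shifted left with a sign, so [R] shifts right with a sign; [n]
   more steps leave the entry [(-1)^n] in the corner. *)
have rowE k : (k <= n)%N ->
    iter k R (delta_mx ord0 ord0) ord0 (inord k) = (-1) ^+ k.
  elim: k => [_|k IHk lt_kn].
    by rewrite /= mxE eqxx -val_eqE /= inordK.
  have := congr1 (fun z : M => z ord0 (inord k))
    (RK (iter k R (delta_mx ord0 ord0))).
  rewrite mxE [RHS]mxE -val_eqE /= inordK ?ltnS ?(ltnW lt_kn) // ltn_eqF // ad_shiftTE.
  rewrite inordK ?ltnS ?(ltnW lt_kn) // lt_kn sub0r IHk ?(ltnW lt_kn) //=.
  by move/(canRL (@opprK _)) => ->; rewrite exprS mulN1r.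
have := rowE n (leqnn n); rewrite -(colE n (leqnn n)) -iterD addnn R0 mxE.
by move/esym/eqP; rewrite signr_eq0.
Qed.

End ExtremalOperator.

(** * The upper bound in general *)

Section UpperBound.

Local Open Scope ring_scope.

Lemma RB0_upper_bound (F : fieldType) n :
  [pchar F] =i pred0 -> all_RB0_nilp F n.+1 n.*2.+1.
Proof.
move=> F0 R0 [linR RB] x.
pose R : {linear 'M[F]_n.+1 -> 'M[F]_n.+1} :=
  HB.pack R0 (GRing.isLinear.Build F _ _ *:%R R0 linR).
have {RB} RB y z : R y * R z = R (R y * z + y * R z) := RB y z.
have an0 := RB1_nilpotent F0 RB.
rewrite -[LHS]/(iter n.*2.+1 R x).
(* The matrices have size [n + 1]: if already [a ^+ n = 0], the general bound [2n] is below
   [2n + 1]. *)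
have [an|an_neq0] := eqVneq (R 1 ^+ n) 0.
  by rewrite (RB_iter_eq0 F0 RB _ an).
have [f ad2f] := regular_nilpotent_lowering an0 an_neq0.
apply: (iter_R_regular F0 an0 an_neq0 ad2f); last exact: RB_exp.
exact: RB_comm.
Qed.

End UpperBound.

Theorem mainTheorem19 (F : fieldType) (n : nat) :
  [pchar F]%R =i pred0 -> (1 <= n)%N -> rb_index_eq F n (2 * n - 1).
Proof.
case: n => // n F0 _.
have -> : 2 * n.+1 - 1 = n.*2.+1 by lia.
by split=> [|m]; [apply: RB0_upper_bound | apply: RB0_lower_bound].
Qed.
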